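(* Let $\epsilon<0.1$. There is a local algorithm (in the adjacency list model) which, given an $n$-vertex unweighted undirected graph $G$ and two adjacent vertices $s,t$ such that every vertex of $G$ other than $s$ and $t$ has degree at most $2$, outputs with probability at least $0.99$ a $(1+\epsilon)$-approximation of $R_G(s,t)$, in time \[O\!\left(\frac{\min\{d(s)^2,d(t)^2\}\cdot\log^2 n\cdot\log\log n}{\epsilon^2}\right),\] where $d(s),d(t)$ denote the degrees of $s$ and $t$.
   Context: For an unweighted undirected graph $G$ with Laplacian $L_G=D_G-A_G$ and pseudo-inverse $L_G^{\dagger}$, the effective resistance is $R_G(s,t)=(\mathbf{1}_s-\mathbf{1}_t)^{\top}L_G^{\dagger}(\mathbf{1}_s-\mathbf{1}_t)$, where $\mathbf{1}_u$ is the indicator vector of $u$. For $C>1$, a value $a$ is a $C$-approximation of a value $b$ if $a\in[b/C,b]$. In the adjacency list model, a local algorithm accesses the graph only via constant-time degree queries (degree of a given vertex), neighbor queries (the $i$-th neighbor of a given vertex) and uniform vertex sampling. *)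

(* Defs.v *)
From HB Require Import structures.
From mathcomp Require Import all_boot all_order all_algebra.
From mathcomp Require Import classical_sets reals exp.

Set Implicit Arguments.
Unset Strict Implicit.
Unset Printing Implicit Defensive.

Import Order.TTheory GRing.Theory Num.Theory.

Local Open Scope ring_scope.

(** * Moore-Penrose pseudo-inverse *)

Definition is_pseudo_inverse (R : realFieldType) m n
    (A : 'M[R]_(m, n)) (X : 'M[R]_(n, m)) : Prop :=
  [/\ A *m X *m A = A, X *m A *m X = X,
      (A *m X)^T = A *m X & (X *m A)^T = X *m A].

(* The default value 0 of xget is never used: see pseudo_inverseP. *)
Definition pseudo_inverse (R : realFieldType) m n (A : 'M[R]_(m, n)) :
    'M[R]_(n, m) :=
  xget 0 [set X | is_pseudo_inverse A X]%classic.

Lemma gram_unitmx (R : realFieldType) m n (B : 'M[R]_(m, n)) :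
  row_free B -> B *m B^T \in unitmx.
Proof.
move=> Bfree; rewrite -row_free_unit -kermx_eq0; apply/rowV0P => u.
move/sub_kermxP => uBB0; suff /eqP : u *m B = 0.
  by rewrite mulmx_free_eq0 // => /eqP.
apply/matrixP => i j; rewrite ord1 [RHS]mxE; set w := u *m B.
have : (w *m w^T) 0 0 = 0.
  by rewrite trmx_mul mulmxA -(mulmxA u) uBB0 mul0mx mxE.
have sqE k : w 0 k * w^T k 0 = w 0 k ^+ 2 by rewrite [w^T _ _]mxE expr2.
rewrite mxE (eq_bigr _ (fun k _ => sqE k)) => /eqP.
rewrite psumr_eq0 => [/allP/(_ j (mem_index_enum _))|k _]; last exact: sqr_ge0.
by rewrite /= sqrf_eq0 => /eqP.
Qed.

Lemma pseudo_inverse_unique (R : realFieldType) m n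
    (A : 'M[R]_(m, n)) (X Y : 'M[R]_(n, m)) :
  is_pseudo_inverse A X -> is_pseudo_inverse A Y -> X = Y.
Proof.
case=> X1 X2 X3 X4 [Y1 Y2 Y3 Y4].
have AXY : A *m X = A *m Y.
  by rewrite -X3 -{1}Y1 -mulmxA trmx_mul X3 Y3 mulmxA X1.
have XAY : X *m A = Y *m A.
  rewrite -X4 -{1}Y1 -[A *m Y *m A]mulmxA [X *m (_ *m _)]mulmxA trmx_mul X4 Y4.
  by rewrite -mulmxA [A *m _]mulmxA X1.
by rewrite -X2 -mulmxA AXY mulmxA XAY Y2.
Qed.

Lemma pseudo_inverse_factor (R : realFieldType) m n r
    (P : 'M[R]_(m, r)) (Q : 'M[R]_(r, n)) :
  row_free P^T -> row_free Q ->
  is_pseudo_inverse (P *m Q)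
    (Q^T *m invmx (Q *m Q^T) *m invmx (P^T *m P) *m P^T).
Proof.
move=> /gram_unitmx; rewrite trmxK => PU /gram_unitmx QU.
set PI := invmx (P^T *m P); set QI := invmx (Q *m Q^T); set X := _ *m P^T.
have QV : Q *m Q^T *m QI = 1%:M by exact: mulmxV.
have PV : PI *m (P^T *m P) = 1%:M by exact: mulVmx.
have PS : PI^T = PI by rewrite trmx_inv trmx_mul trmxK.
have QS : QI^T = QI by rewrite trmx_inv trmx_mul trmxK.
have AX : P *m Q *m X = P *m PI *m P^T.
  by rewrite /X -!mulmxA (mulmxA Q Q^T) (mulmxA (Q *m Q^T) QI) QV mul1mx.
have XA : X *m (P *m Q) = Q^T *m QI *m Q.
  by rewrite /X -!mulmxA (mulmxA P^T P) (mulmxA PI) PV mul1mx.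
split.
- by rewrite AX -!mulmxA (mulmxA P^T P) (mulmxA PI) PV mul1mx.
- by rewrite XA /X -!mulmxA (mulmxA Q Q^T) (mulmxA (Q *m Q^T) QI) QV mul1mx.
- by rewrite AX !trmx_mul trmxK PS mulmxA.
- by rewrite XA !trmx_mul trmxK QS mulmxA.
Qed.

Lemma pseudo_inverseP (R : realFieldType) m n (A : 'M[R]_(m, n)) :
  is_pseudo_inverse A (pseudo_inverse A).
Proof.
apply: (@xgetPex _ 0 [set Z | is_pseudo_inverse A Z]%classic).
eexists; rewrite /= -{1}(mulmx_base A); apply: pseudo_inverse_factor.
  by rewrite /row_free mxrank_tr; exact: col_base_full.
exact: row_base_free.
Qed.

(** * Graphs and effective resistance *)

(* A simple graph on the vertex set 'I_n is a symmetric irreflexive relation. *)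

Definition degree n (e : rel 'I_n) (v : 'I_n) : nat := #|[set u | e v u]|.

Definition laplacian (R : realFieldType) n (e : rel 'I_n) : 'M[R]_n :=
  \matrix_(i, j) ((i == j)%:R * (degree e i)%:R - (e i j)%:R).

Definition indicator (R : realFieldType) n (u : 'I_n) : 'cV[R]_n :=
  delta_mx u 0.

Definition effective_resistance (R : realFieldType) n (e : rel 'I_n)
    (s t : 'I_n) : R :=
  ((indicator R s - indicator R t)^T *m pseudo_inverse (laplacian R e)
     *m (indicator R s - indicator R t)) 0 0.

Definition approximates (R : realFieldType) (C a b : R) : bool :=
  b / C <= a <= b.

(* The order of each list is arbitrary. *)
Definition adjacency_lists n (e : rel 'I_n) (nb : 'I_n -> seq 'I_n) : Prop :=
  forall v, uniq (nb v) /\ (forall u, (u \in nb v) = e v u).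

(** * Randomized local algorithms

    Programs run on a random access machine with an unbounded memory of
    natural-number cells and an unbounded memory of real-number cells, both
    indirectly addressable.  Natural numbers support only addition, truncated
    subtraction and comparison; multiplication is left out, as usual in
    unit-cost machines on unbounded integers.  Real numbers support the field
    operations and comparison, but no rounding.  The graph is visible only
    through the three query commands. *)

Inductive nexp : Type :=
| NConst of nat
| NMem of nexp
| NAdd of nexp & nexp
| NSub of nexp & nexp.

Inductive rexp : Type :=
| RMem of nexp
| ROfNat of nexp
| RAdd of rexp & rexp
| RSub of rexp & rexp
| RMul of rexp & rexp
| RDiv of rexp & rexp.

Inductive bexp : Type :=
| NLe of nexp & nexp
| RLe of rexp & rexp
| BNot of bexp
| BAnd of bexp & bexp.

(* In every command that writes, the first argument is the address written. *)
Inductive cmd : Type :=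
| NSet of nexp & nexp
| RSet of nexp & rexp
| QDegree of nexp & nexp
| QNeighbor of nexp & nexp & nexp
| QSample of nexp
| Coin of nexp
| Seq of cmd & cmd
| If of bexp & cmd & cmd
| While of bexp & cmd.

Record state (R : Type) := State { nmem : nat -> nat; rmem : nat -> R }.

Definition update (T : Type) (m : nat -> T) (a : nat) (x : T) : nat -> T :=
  fun b => if b == a then x else m b.

Definition set_nmem (R : Type) (st : state R) (a x : nat) : state R :=
  State (update (nmem st) a x) (rmem st).

Definition set_rmem (R : Type) (st : state R) (a : nat) (x : R) : state R :=
  State (nmem st) (update (rmem st) a x).

Section Semantics.
Variables (R : realFieldType) (n : nat) (nb : 'I_n -> seq 'I_n).

Fixpoint neval (st : state R) (a : nexp) : nat :=
  match a with
  | NConst c => c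
  | NMem a1 => nmem st (neval st a1)
  | NAdd a1 a2 => (neval st a1 + neval st a2)%N
  | NSub a1 a2 => (neval st a1 - neval st a2)%N
  end.

Fixpoint reval (st : state R) (x : rexp) : R :=
  match x with
  | RMem a => rmem st (neval st a)
  | ROfNat a => (neval st a)%:R
  | RAdd x1 x2 => reval st x1 + reval st x2
  | RSub x1 x2 => reval st x1 - reval st x2
  | RMul x1 x2 => reval st x1 * reval st x2
  | RDiv x1 x2 => reval st x1 / reval st x2
  end.

Fixpoint beval (st : state R) (b : bexp) : bool :=
  match b with
  | NLe a1 a2 => (neval st a1 <= neval st a2)%N
  | RLe x1 x2 => reval st x1 <= reval st x2
  | BNot b1 => ~~ beval st b1
  | BAnd b1 b2 => beval st b1 && beval st b2
  end.

(* Queries about a number that is not a vertex return the degree 0; a missing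
   neighbor is reported as n, which is not a vertex. *)
Definition degree_query (v : nat) : nat :=
  if insub v is Some u then size (nb u) else 0%N.

Definition neighbor_query (v i : nat) : nat :=
  if insub v is Some u then nth n (map val (nb u)) i else n.

(* The list of commands that remain to be executed, and the memory. *)
Definition config : Type := (seq cmd * state R)%type.

(* The possible successors of a configuration, all equally likely (counted with
   multiplicity).  A step evaluates the expressions of a single command, hence
   performs a number of elementary operations bounded by a constant that
   depends on the program only. *)
Definition step (c : cmd) (cs : seq cmd) (st : state R) : seq config :=
  match c with
  | NSet a x => [:: (cs, set_nmem st (neval st a) (neval st x))]
  | RSet a x => [:: (cs, set_rmem st (neval st a) (reval st x))]
  | QDegree a v =>
      [:: (cs, set_nmem st (neval st a) (degree_query (neval st v)))]
  | QNeighbor a v i =>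
      [:: (cs, set_nmem st (neval st a)
                 (neighbor_query (neval st v) (neval st i)))]
  | QSample a => [seq (cs, set_nmem st (neval st a) (val v)) | v <- enum 'I_n]
  | Coin a => [seq (cs, set_nmem st (neval st a) (nat_of_bool b))
                 | b <- [:: false; true]]
  | Seq c1 c2 => [:: (c1 :: c2 :: cs, st)]
  | If b c1 c2 => [:: ((if beval st b then c1 else c2) :: cs, st)]
  | While b c1 => [:: (if beval st b then c1 :: c :: cs else cs, st)]
  end.

(* The probability that the machine halts within k steps and that its output,
   which is the content of real cell 0 on halting, satisfies E. *)
Fixpoint output_prob (E : pred R) (k : nat) (cf : config) : R :=
  match cf.1 with
  | [::] => (E (rmem cf.2 0))%:R
  | c :: cs =>
      if k is k1.+1 then
        (\sum_(cf1 <- step c cs cf.2) output_prob E k1 cf1)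
          / (size (step c cs cf.2))%:R
      else 0
  end.

(* The input: n, s and t in natural-number cells 0, 1 and 2, and epsilon in real
   cell 0. *)
Definition init_config (p : cmd) (s t : 'I_n) (eps : R) : config :=
  ([:: p],
   State (fun a => nth 0%N [:: n; val s; val t] a) (fun a => nth 0 [:: eps] a)).

(* Whatever the random choices, the program halts within k steps. *)
Definition runs_in_time (p : cmd) (s t : 'I_n) (eps : R) (k : nat) : Prop :=
  output_prob predT k (init_config p s t eps) = 1.

End Semantics.

(* Main.v *)
(* The algorithm is deterministic. Let x be a potential with L x = 1_s - 1_t, so
   that rho = x_s - x_t is the effective resistance. Away from s and t the
   potential is harmonic and degrees are at most 2, so along the walk that starts
   at s with a neighbor u the potential changes by the constant drop
   delta_u = x_s - x_u at every step. If delta_u <> 0 the walk visits no vertex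
   twice and must end: delta_u = rho / l if it reaches t after l steps, and
   delta_u = 0 if it returns to s or runs into a dead end. As the drops sum to 1,
   1 / rho is the sum of the 1 / l. Walks still running after l >= d(s) / eps
   steps are given the weight 1 / l <= eps / d(s); this overestimates the sum,
   which is at least 1, by at most eps. Starting from the endpoint of smaller
   degree d, the running time is O(d^2 / eps). *)

Require Import Defs.
From HB Require Import structures.
From mathcomp Require Import all_boot all_order all_algebra.
From mathcomp Require Import ring lra.
From mathcomp Require Import classical_sets reals sequences exp.

Set Implicit Arguments.
Unset Strict Implicit.
Unset Printing Implicit Defensive.

Import Order.TTheory GRing.Theory Num.Theory.

Local Open Scope ring_scope.

(** * Electrical potentials *)

Lemma laplacian_mulE (R : realFieldType) n (e : rel 'I_n) (x : 'cV[R]_n) v :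
  (laplacian R e *m x) v 0 = \sum_(u | e v u) (x v 0 - x u 0).
Proof.
rewrite mxE sumrB sumr_const [RHS]addrC.
under eq_bigr do rewrite mxE mulrBl.
rewrite sumrB [RHS]addrC; congr (_ - _).
  rewrite (bigD1 v) //= eqxx mul1r big1 ?addr0 => [|u /negPf vu].
    by rewrite mulr_natl /degree cardsE.
  by rewrite eq_sym vu !mul0r.
by rewrite [RHS]big_mkcond; apply: eq_bigr => u _; case: e; rewrite (mul1r, mul0r).
Qed.

Lemma laplacian_sym (R : realFieldType) n (e : rel 'I_n) :
  symmetric e -> (laplacian R e)^T = laplacian R e.
Proof.
move=> e_sym; apply/matrixP => i j; rewrite !mxE e_sym [in LHS]eq_sym.
by case: eqVneq => [->|]; rewrite ?mul0r.
Qed.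

(** Summing over oriented edges from either end gives two forms of the same quantity; added edge by
    edge they complete a square, whence the factor 2. *)
Lemma laplacian_energy (R : realFieldType) n (e : rel 'I_n) (x : 'cV[R]_n) :
  symmetric e ->
  (x^T *m laplacian R e *m x) 0 0 *+ 2 =
  \sum_i \sum_(j | e i j) (x i 0 - x j 0) ^+ 2.
Proof.
move=> e_sym.
have E1 : (x^T *m laplacian R e *m x) 0 0 =
    \sum_i \sum_(j | e i j) x i 0 * (x i 0 - x j 0).
  rewrite -mulmxA mxE; apply: eq_bigr => i _.
  by rewrite laplacian_mulE mxE mulr_sumr.
have E2 : (x^T *m laplacian R e *m x) 0 0 =
    \sum_i \sum_(j | e i j) x j 0 * (x j 0 - x i 0).
  rewrite E1 (exchange_big_dep predT) //=; apply: eq_bigr => i _.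
  by apply: eq_bigl => j; rewrite e_sym.
rewrite mulr2n {1}E1 E2 -big_split /=; apply: eq_bigr => i _.
by rewrite -big_split /=; apply: eq_bigr => j _; ring.
Qed.

Lemma indicatorBE (R : realFieldType) n (s t v : 'I_n) :
  (indicator R s - indicator R t) v 0 = (v == s)%:R - (v == t)%:R.
Proof. by rewrite !mxE eqxx !andbT. Qed.

Lemma indicatorB_mul (R : realFieldType) n (s t : 'I_n) (x : 'cV[R]_n) :
  ((indicator R s - indicator R t)^T *m x) 0 0 = x s 0 - x t 0.
Proof.
rewrite linearB /= mulmxBl /indicator !trmx_delta -!rowE.
by rewrite !mxE.
Qed.

(** The graph may be disconnected, so [b] must be shown to lie in the range of [L]. The residual [y]
    is in the kernel of [L], hence agrees at the adjacent [s] and [t]; it is then orthogonal to [b]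
    and to the range of [L], hence to itself. *)
Lemma effective_resistance_potential (R : realFieldType) n (e : rel 'I_n)
    (s t : 'I_n) : symmetric e -> e s t ->
  exists x : 'cV[R]_n,
    [/\ laplacian R e *m x = indicator R s - indicator R t,
        effective_resistance R e s t = x s 0 - x t 0 &
        0 <= effective_resistance R e s t].
Proof.
move=> e_sym est; rewrite /effective_resistance.
set L := laplacian R e; set b := indicator R s - _; set X := pseudo_inverse L.
have [P1 _ P3 _] := pseudo_inverseP L; rewrite -/X in P1 P3.
have LT : L^T = L by exact: laplacian_sym.
pose y := b - L *m X *m b.
(* As [L] and [L *m X] are symmetric, [L *m L *m X] is the transpose of [L *m X *m L], that is,
   [L]. *)
have Ly : L *m y = 0.
  rewrite mulmxBr !mulmxA -{1}LT -{1}P1 -[(L *m X *m L)]mulmxA.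
  rewrite [in X in X - _]mulmxA trmx_mul P3 LT.
  by rewrite !mulmxA subrr.
(* Zero energy forces equal values across every edge. *)
have yst : y s 0 = y t 0.
  have := laplacian_energy y e_sym.
  rewrite -mulmxA -/L Ly mulmx0 mxE mul0rn => /esym/eqP.
  rewrite psumr_eq0 => [|i _]; last by apply: sumr_ge0 => j _; exact: sqr_ge0.
  move=> /allP/(_ s (mem_index_enum _)) /=.
  rewrite psumr_eq0 => [|i _]; last exact: sqr_ge0.
  move=> /allP/(_ t (mem_index_enum _)) /=; rewrite est /= sqrf_eq0 subr_eq0.
  by move/eqP.
have by0 : b^T *m y = 0.
  by apply/matrixP => i j; rewrite !ord1 indicatorB_mul yst subrr mxE.
have yy0 : y^T *m y = 0.
  have -> : y^T = b^T - (L *m X *m b)^T by rewrite linearB.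
  rewrite mulmxBl by0 trmx_mul P3.
  by rewrite -mulmxA -P3 trmx_mul LT -(mulmxA X^T) Ly !mulmx0 subrr.
have y0 : y = 0.
  apply/colP => i; transitivity (0 : R); last by rewrite mxE.
  have /eqP : (y^T *m y) 0 0 = 0 by rewrite yy0 mxE.
  rewrite [(_ *m _) _ _]mxE.
  rewrite psumr_eq0 => [|k _]; last by rewrite [y^T _ _]mxE -expr2 sqr_ge0.
  move=> /allP/(_ i (mem_index_enum _)) /=.
  by rewrite [y^T _ _]mxE -expr2 sqrf_eq0 => /eqP.
have Lx : L *m (X *m b) = b.
  by apply/eqP; rewrite mulmxA eq_sym -subr_eq0; apply/eqP.
exists (X *m b); split=> //; first by rewrite -mulmxA indicatorB_mul.
(* The resistance is the quadratic form of [L] at the potential, half of a sum of squares. *)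
rewrite -(pmulrn_lge0 _ (isT : (0 < 2)%N)) -mulmxA.
have -> : b^T *m (X *m b) = (X *m b)^T *m L *m (X *m b).
  by rewrite -{1}Lx trmx_mul LT.
rewrite laplacian_energy //.
by apply: sumr_ge0 => i _; apply: sumr_ge0 => j _; exact: sqr_ge0.
Qed.

Lemma effective_resistanceC (R : realFieldType) n (e : rel 'I_n) (s t : 'I_n) :
  effective_resistance R e s t = effective_resistance R e t s.
Proof.
rewrite /effective_resistance.
have -> : indicator R s - indicator R t = - (indicator R t - indicator R s).
  by rewrite opprB.
move: (indicator R t - _) => v.
have -> : (- v)^T = - v^T by rewrite linearN.
by rewrite mulmxN !mulNmx opprK.
Qed.

(** * Walks along vertices of degree 2 *)

Lemma neighbor_query_ord n (nb : 'I_n -> seq 'I_n) (v : 'I_n) i :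
  neighbor_query nb (val v) i = nth n (map val (nb v)) i.
Proof. by rewrite /neighbor_query valK. Qed.

Lemma neighbor_query_none n (nb : 'I_n -> seq 'I_n) i :
  neighbor_query nb n i = n.
Proof. by rewrite /neighbor_query insubF ?ltnn. Qed.

Lemma degree_query_ord n (nb : 'I_n -> seq 'I_n) (v : 'I_n) :
  degree_query nb (val v) = size (nb v).
Proof. by rewrite /degree_query valK. Qed.

Lemma degreeE n (e : rel 'I_n) nb v :
  adjacency_lists e nb -> degree e v = size (nb v).
Proof.
case/(_ v) => /card_uniqP <- nbE; rewrite /degree cardsE.
by apply: eq_card => u; rewrite nbE.
Qed.

Lemma sum_neighbors (V : nmodType) n (e : rel 'I_n) nb v (F : 'I_n -> V) :
  adjacency_lists e nb -> \sum_(u | e v u) F u = \sum_(u <- nb v) F u.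
Proof.
by case/(_ v) => nbU nbE; rewrite big_uniq //; apply: eq_bigl => u /=; rewrite nbE.
Qed.

(* A walk is a pair (previous vertex, current vertex); since a missing neighbor
   is reported as n, a walk that runs into a dead end moves to n and stays. *)
Definition walk_step n (nb : 'I_n -> seq 'I_n) (w : nat * nat) : nat * nat :=
  (w.2, if neighbor_query nb w.2 0 == w.1 then neighbor_query nb w.2 1
        else neighbor_query nb w.2 0).

Definition walk n (nb : 'I_n -> seq 'I_n) (s u : 'I_n) (j : nat) : nat * nat :=
  iter j (walk_step nb) (val s, val u).

Lemma walkS n (nb : 'I_n -> seq 'I_n) s u j :
  walk nb s u j.+1 = walk_step nb (walk nb s u j).
Proof. by []. Qed.

(** A dead end does not count as an end: such a walk stays at [n] until its length cuts it off. *)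
Definition walk_ended n (nb : 'I_n -> seq 'I_n) (s t u : 'I_n) (j : nat) :=
  ((walk nb s u j).2 == s) || ((walk nb s u j).2 == t).

(** Index 0 is already one step away from [s], so index [j] means length [j.+1]. *)
Definition walk_weight (R : realFieldType) n (nb : 'I_n -> seq 'I_n)
    (s u : 'I_n) (j : nat) : R :=
  if (walk nb s u j).2 == s then 0 else j.+1%:R^-1.

Section Potential.
Variables (R : realFieldType) (n : nat) (e : rel 'I_n) (nb : 'I_n -> seq 'I_n).
Variables (s t : 'I_n) (x : 'cV[R]_n).
Hypotheses (e_sym : symmetric e) (e_irr : irreflexive e).
Hypotheses (nbP : adjacency_lists e nb) (est : e s t).
Hypothesis deg2 : forall v, v != s -> v != t -> (degree e v <= 2)%N.
Hypothesis Lx : laplacian R e *m x = indicator R s - indicator R t.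

Let rho := x s 0 - x t 0.
Let drop u := x s 0 - x u 0.

Lemma source_neq_sink : s != t.
Proof. by apply: contraTneq est => ->; rewrite e_irr. Qed.

Lemma sum_drop : \sum_(u <- nb s) drop u = 1.
Proof.
rewrite -(sum_neighbors _ _ nbP) -laplacian_mulE Lx indicatorBE eqxx.
by rewrite (negPf source_neq_sink) subr0.
Qed.

Lemma potential_harmonic v : v != s -> v != t ->
  \sum_(u <- nb v) (x v 0 - x u 0) = 0.
Proof.
move=> vs vt; rewrite -(sum_neighbors _ _ nbP) -laplacian_mulE Lx indicatorBE.
by rewrite (negPf vs) (negPf vt) subrr.
Qed.

(** Current is conserved at an intermediate vertex [c]: with two neighbors the drop leaving equals
    the drop entering, and the walk moves to the neighbor other than [p]; with one neighbor the
    entering drop vanishes and the walk moves to [n]. *)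
Lemma walk_potential u : e s u -> forall j,
  (forall i, (i < j)%N -> ~~ walk_ended nb s t u i) ->
  (exists p c : 'I_n, [/\ walk nb s u j = (val p, val c), e p c,
     x p 0 - x c 0 = drop u & x c 0 = x s 0 - j.+1%:R * drop u]) \/
  (walk nb s u j).2 = n /\ drop u = 0.
Proof.
move=> esu; elim=> [_|j IHj jP].
  by left; exists s, u; split=> //; rewrite mul1r /drop opprB addrC subrK.
have [i ij|[p [c [wE epc dpc xc]]]|[wn d0]] := IHj.
- by apply: jP; exact: ltnW.
- have := jP j (leqnn _); rewrite /walk_ended wE.
  rewrite negb_or => /andP[cs ct].
  have {}cs : c != s := cs; have {}ct : c != t := ct.
  have := potential_harmonic cs ct; have := deg2 cs ct; rewrite (degreeE c nbP).
  have [nbU nbE] := nbP c; have : p \in nb c by rewrite nbE e_sym.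
  rewrite walkS wE /walk_step /= !neighbor_query_ord; move: nbU nbE.
  have step v : e c v -> x c 0 - x v 0 = drop u ->
    exists p0 c0 : 'I_n, [/\ (val c, val v) = (val p0, val c0), e p0 c0,
       x p0 0 - x c0 0 = drop u & x c0 0 = x s 0 - j.+2%:R * drop u].
    move=> ecv dcv; exists c, v; split=> //.
    by rewrite -[j.+2]addn1 natrD mulrDl mul1r opprD addrA -xc -dcv; ring.
  case: (nb c) => [|a [|b []]] //= nbU nbE; rewrite !inE ?big_cons ?big_nil.
    move=> /eqP <- _; rewrite addr0 eqxx => /eqP; rewrite -oppr_eq0 opprB dpc.
    by move=> /eqP d0; right.
  move=> pab _ sum0; left; move: pab nbU.
  have [ea eb] : e c a /\ e c b by rewrite -!nbE !inE !eqxx orbT.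
  case/orP => /eqP eqp; rewrite -eqp ?eqxx in sum0 *.
    by move=> _; apply: step => //; lra.
  rewrite inE andbT => ap; rewrite (inj_eq val_inj) (negPf ap).
  by apply: step => //; lra.
- right; split=> //; rewrite walkS /walk_step /= wn !neighbor_query_none.
  by rewrite if_same.
Qed.

(** Otherwise [n.+1] positions would have pairwise distinct potentials, but there are only [n]
    vertices. *)
Lemma walk_ends u : e s u -> drop u != 0 -> exists j, walk_ended nb s t u j.
Proof.
move=> esu d0; pose P := [exists j : 'I_n.+1, walk_ended nb s t u j].
have [/existsP[j jP]|] := boolP P; first by exists j.
rewrite negb_exists => /forallP notP; exfalso.
have pos (j : 'I_n.+1) : {c : 'I_n | x c 0 = x s 0 - j.+1%:R * drop u}.
  apply: sig_eqW; have [i ij|[p [c [_ _ _ xc]]]|[_ d1]] := walk_potential esu (j := j).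
  - exact: (notP (Ordinal (ltn_trans ij (ltn_ord j)))).
  - by exists c.
  - by rewrite d1 eqxx in d0.
have /leq_card : injective (fun j => sval (pos j)).
  move=> i j eq_ij; have := svalP (pos i); rewrite eq_ij (svalP (pos j)).
  by move/addrI/oppr_inj/(mulIf d0)/eqP; rewrite eqr_nat eqSS => /eqP/val_inj.
by rewrite !card_ord ltnn.
Qed.

(** At [t] the potential has fallen by [rho] in [j.+1] equal drops; back at [s] it has fallen by 0,
    so each drop is 0. *)
Lemma drop_ended u j : e s u ->
  (forall i, (i < j)%N -> ~~ walk_ended nb s t u i) -> walk_ended nb s t u j ->
  drop u = rho * walk_weight R nb s u j.
Proof.
move=> esu jP; rewrite /walk_ended /walk_weight.
have [[p [c [-> /= _ _ xc]]]|[-> _]] := walk_potential esu jP; last first.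
  by rewrite !gtn_eqF.
have j0 : j.+1%:R != 0 :> R by rewrite pnatr_eq0.
rewrite !(inj_eq val_inj); case: eqVneq => [cs _|_ /= /eqP ct].
  move: xc; rewrite cs mulr0 => /eqP; rewrite -subr_eq0 subKr.
  by rewrite mulf_eq0 (negPf j0) => /eqP.
by rewrite /rho -ct xc subKr mulrC mulKf.
Qed.

(** For a walk cut off at [j], the true drop is 0 or comes from an end later than [j], so it lies
    between 0 and [rho / j.+1], which is at most [rho * b]. *)
Lemma drop_bounds (b : R) u j : 0 <= rho -> e s u ->
  (forall i, (i < j)%N -> ~~ walk_ended nb s t u i) ->
  walk_ended nb s t u j \/ j.+1%:R^-1 <= b ->
  0 <= b ->
  [/\ 0 <= drop u, drop u <= rho * walk_weight R nb s u j &
      rho * walk_weight R nb s u j <= drop u + rho * b].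
Proof.
move=> rho0 esu jP stop b0.
have w0 i : 0 <= walk_weight R nb s u i.
  by rewrite /walk_weight; case: ifP => // _; rewrite invr_ge0.
have [jE|jN] := boolP (walk_ended nb s t u j).
  by rewrite (drop_ended esu jP jE); split=> //; rewrite ?lerDl mulr_ge0.
have {stop} jb : j.+1%:R^-1 <= b by case: stop jN => // ->.
have -> : walk_weight R nb s u j = j.+1%:R^-1.
  by move: jN; rewrite /walk_ended /walk_weight; case: eqP.
suff [d0 dj] : 0 <= drop u /\ drop u <= rho * j.+1%:R^-1.
  split=> //; apply: le_trans (ler_wpM2l rho0 jb) _; by rewrite lerDr.
have [->|dN0] := eqVneq (drop u) 0; first by rewrite mulr_ge0 ?invr_ge0.
case: (ex_minnP (walk_ends esu dN0)) => k kE kmin.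
have kP i : (i < k)%N -> ~~ walk_ended nb s t u i.
  by rewrite ltnNge; apply: contra => /kmin.
rewrite (drop_ended esu kP kE) mulr_ge0 //; split=> //.
apply: ler_wpM2l => //; rewrite /walk_weight; case: ifP => _.
  by rewrite invr_ge0.
rewrite lef_pV2 ?posrE ?ltr0n // ler_nat ltnS leqNgt.
by apply: contraNN jN => kj; rewrite (negPf (jP _ kj)) in kE.
Qed.

(** Summing the bounds on the drops gives 1 <= [rho * S] <= 1 + [rho * eps]. The edge from [s] to
    [t] alone carries drop [rho], so [rho] <= 1 and the upper bound becomes 1 + [eps]. *)
Lemma weights_approximate (eps : R) (J : 'I_n -> nat) :
  0 <= rho -> 0 < eps ->
  (forall u, u \in nb s -> forall i, (i < J u)%N -> ~~ walk_ended nb s t u i) ->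
  (forall u, u \in nb s -> walk_ended nb s t u (J u) \/
     (size (nb s))%:R <= (J u).+1%:R * eps) ->
  approximates (1 + eps) (1 / \sum_(u <- nb s) walk_weight R nb s u (J u)) rho.
Proof.
move=> rho0 eps0 notE stop; set S := \sum_(u <- _) _.
have [nbU nbE] := nbP s.
have tin : t \in nb s by rewrite nbE.
have d0 : 0 < (size (nb s))%:R :> R by rewrite ltr0n; case: (nb s) tin.
(* The error allowed per walk, so that all walks from [s] together err by [eps]. *)
pose b := eps / (size (nb s))%:R.
have b0 : 0 < b by rewrite divr_gt0.
have bounds u : u \in nb s -> [/\ 0 <= drop u,
    drop u <= rho * walk_weight R nb s u (J u) &
    rho * walk_weight R nb s u (J u) <= drop u + rho * b].
  move=> uin; apply: drop_bounds => //; last exact: ltW.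
  - by rewrite -nbE.
  - exact: notE.
  - case: (stop u uin) => [|le]; [by left | right].
    by rewrite /b lter_pdivlMr // mulrC ler_pdivrMr ?ltr0n // mulrC.
have rhoS : 1 <= rho * S.
  rewrite -sum_drop mulr_sumr big_seq [leRHS]big_seq.
  by apply: ler_sum => u /bounds[].
have rhoS' : rho * S <= 1 + rho * eps.
  have -> : 1 + rho * eps = \sum_(u <- nb s) (drop u + rho * b).
    rewrite big_split /= sum_drop big_const_seq count_predT iter_addr_0.
    by rewrite -mulrnAr -mulr_natr /b divfK // gt_eqF.
  rewrite mulr_sumr big_seq [leRHS]big_seq.
  by apply: ler_sum => u /bounds[].
have rho1 : rho <= 1.
  rewrite -sum_drop (bigD1_seq t) //= lerDl big_seq_cond.
  by apply: sumr_ge0 => u /andP[/bounds[]].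
have rhogt0 : 0 < rho.
  rewrite lt_neqAle rho0 andbT; apply: contraTneq rhoS => <-.
  by rewrite mul0r -ltNge.
have S0 : 0 < S by rewrite -(pmulr_rgt0 _ rhogt0); lra.
have e1 : 0 < 1 + eps by lra.
apply/andP; split; last by rewrite ler_pdivrMr.
rewrite ler_pdivrMr // mulrAC ler_pdivlMr // (le_trans rhoS') // mul1r lerD2l.
by rewrite ger_pMl.
Qed.

End Potential.

(** * Execution of programs *)

Section Execution.
Variables (R : realFieldType) (n : nat) (nb : 'I_n -> seq 'I_n).

(** Quantifying over the continuation [cs] and the remaining budget [k] makes exact step counts add
    up under sequencing. *)
Definition executes (c : cmd) (st : state R) (m : nat) (st' : state R) : Prop :=
  forall E k cs,
    output_prob nb E (m + k) (c :: cs, st) = output_prob nb E k (cs, st').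

Definition reaches (c : cmd) (st : state R) (m : nat) (Q : state R -> Prop) :
    Prop :=
  exists m' st', [/\ (m' <= m)%N, executes c st m' st' & Q st'].

Lemma reaches_le m1 m2 c st (Q1 Q2 : state R -> Prop) :
  (m1 <= m2)%N -> (forall st', Q1 st' -> Q2 st') ->
  reaches c st m1 Q1 -> reaches c st m2 Q2.
Proof.
move=> m12 Q12 [m [st' [mm1 ex /Q12 Q]]]; exists m, st'; split=> //.
exact: leq_trans mm1 m12.
Qed.

Lemma reaches_step c c' st st' m Q :
  (forall cs, step nb c cs st = [:: (c' :: cs, st')]) ->
  reaches c' st' m Q -> reaches c st m.+1 Q.
Proof.
move=> cE [m' [st2 [mm' ex HQ]]]; exists m'.+1, st2; split=> // E k cs.
by rewrite addSn /= cE big_seq1 divr1 ex.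
Qed.

Lemma reaches_atom c st st' (Q : state R -> Prop) :
  (forall cs, step nb c cs st = [:: (cs, st')]) -> Q st' -> reaches c st 1 Q.
Proof.
move=> cE HQ; exists 1%N, st'; split=> // E k cs.
by rewrite add1n /= cE big_seq1 divr1.
Qed.

Lemma reaches_nset a x st (Q : state R -> Prop) :
  Q (set_nmem st (neval st a) (neval st x)) -> reaches (NSet a x) st 1 Q.
Proof. exact: reaches_atom. Qed.

Lemma reaches_rset a x st (Q : state R -> Prop) :
  Q (set_rmem st (neval st a) (reval st x)) -> reaches (RSet a x) st 1 Q.
Proof. exact: reaches_atom. Qed.

Lemma reaches_degree a v st (Q : state R -> Prop) :
  Q (set_nmem st (neval st a) (degree_query nb (neval st v))) ->
  reaches (QDegree a v) st 1 Q.
Proof. exact: reaches_atom. Qed.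

Lemma reaches_neighbor a v i st (Q : state R -> Prop) :
  Q (set_nmem st (neval st a) (neighbor_query nb (neval st v) (neval st i))) ->
  reaches (QNeighbor a v i) st 1 Q.
Proof. exact: reaches_atom. Qed.

Lemma reaches_if b c1 c2 st m Q :
  reaches (if beval st b then c1 else c2) st m Q -> reaches (If b c1 c2) st m.+1 Q.
Proof. exact: reaches_step. Qed.

Lemma reaches_seq c1 c2 st m1 m2 Q :
  reaches c1 st m1 (fun st1 => reaches c2 st1 m2 Q) ->
  reaches (Seq c1 c2) st (m1 + m2).+1 Q.
Proof.
move=> [m1' [st1 [le1 ex1 [m2' [st2 [le2 ex2 HQ]]]]]].
exists (m1' + m2').+1, st2; split=> // [|E k cs]; first exact: leq_add.
by rewrite addSn /= big_seq1 divr1 -addnA ex1 ex2.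
Qed.

(** Every iteration pays one step for its guard; the last step is the failing guard. *)
Lemma reaches_while b c N m (Inv : nat -> state R -> Prop) st :
  (forall i st', (i <= N)%N -> Inv i st' -> beval st' b = (i < N)%N) ->
  (forall i st', (i < N)%N -> Inv i st' -> reaches c st' m (Inv i.+1)) ->
  Inv 0%N st -> reaches (While b c) st (N * m.+1).+1 (Inv N).
Proof.
move=> bE cI I0.
suff gen f : forall i st', (i + f = N)%N -> Inv i st' ->
    reaches (While b c) st' (f * m.+1).+1 (Inv N) by exact: (gen _ 0%N).
elim: f => [|f IHf] i st' ifN Ii.
  rewrite addn0 in ifN; subst N.
  by apply: (reaches_atom _ Ii) => cs /=; rewrite (bE _ _ _ Ii) // ltnn.
have iN : (i < N)%N by rewrite -ifN -addSnnS leq_addr.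
have [m1 [st1 [le1 ex1 Ii1]]] := cI i st' iN Ii.
have [|m2 [st2 [le2 ex2 HN]]] := IHf i.+1 st1 _ Ii1; first by rewrite addSnnS.
exists (m1 + m2).+1, st2; split=> // [|E k cs].
  by rewrite ltnS mulSn addSnnS leq_add.
rewrite addSn /= (bE _ _ (ltnW iN) Ii) iN big_seq1 divr1 -addnA.
by rewrite ex1 ex2.
Qed.

End Execution.

(** * The algorithm as a program *)

Definition ncell (a : nat) : nexp := NMem (NConst a).
Definition nassign (a : nat) (x : nexp) : cmd := NSet (NConst a) x.
(** An equality test on naturals, by antisymmetry; inequality is its negation. *)
Definition neq_test (a b : nexp) : bexp := BAnd (NLe a b) (NLe b a).
Definition skip : cmd := nassign 10 (NConst 0).

(* Natural-number cells: 1, 2 the two endpoints, 3, 4 their degrees, 5 the index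
   of the neighbor of cell 1 from which a walk starts, 6, 7 the previous and the
   current vertex of the walk, 8 its length, 9 scratch. Real cell 1 accumulates
   the weights of the walks. *)
Definition walk_body : cmd :=
  Seq (QNeighbor (NConst 9) (ncell 7) (NConst 0))
 (Seq (If (neq_test (ncell 9) (ncell 6))
          (QNeighbor (NConst 9) (ncell 7) (NConst 1))
          skip)
 (Seq (nassign 6 (ncell 7))
 (Seq (nassign 7 (ncell 9))
      (nassign 8 (NAdd (ncell 8) (NConst 1)))))).

(** The cutoff d / eps is compared as d against length times eps, since reals cannot be rounded. *)
Definition walk_guard : bexp :=
  BAnd (BNot (RLe (ROfNat (ncell 3))
                  (RMul (ROfNat (ncell 8)) (RMem (NConst 0)))))
       (BAnd (BNot (neq_test (ncell 7) (ncell 1)))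
             (BNot (neq_test (ncell 7) (ncell 2)))).

Definition neighbor_body : cmd :=
  Seq (nassign 6 (ncell 1))
 (Seq (QNeighbor (NConst 7) (ncell 1) (ncell 5))
 (Seq (nassign 8 (NConst 1))
 (Seq (While walk_guard walk_body)
 (Seq (If (neq_test (ncell 7) (ncell 1))
          skip
          (RSet (NConst 1) (RAdd (RMem (NConst 1))
             (RDiv (ROfNat (NConst 1)) (ROfNat (ncell 8))))))
      (nassign 5 (NAdd (ncell 5) (NConst 1))))))).

Definition swap_endpoints : cmd :=
  Seq (nassign 9 (ncell 1))
 (Seq (nassign 1 (ncell 2))
 (Seq (nassign 2 (ncell 9))
      (nassign 3 (ncell 4)))).

Definition resistance_program : cmd :=
  Seq (QDegree (NConst 3) (ncell 1))
 (Seq (QDegree (NConst 4) (ncell 2))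
 (Seq (If (NLe (ncell 3) (ncell 4)) skip swap_endpoints)
 (Seq (While (BNot (NLe (ncell 3) (ncell 5))) neighbor_body)
      (RSet (NConst 0) (RDiv (ROfNat (NConst 1)) (RMem (NConst 1))))))).

(** * Correctness and step counts of the program *)

Section Program.
Variables (R : realFieldType) (n : nat) (nb : 'I_n -> seq 'I_n) (eps : R).

Lemma beval_neq_test (st : state R) a b :
  beval st (neq_test a b) = (neval st a == neval st b).
Proof. by rewrite /= eqn_leq. Qed.

Section Endpoints.
(** [J u] is the first index at which the guard fails for the walk through [u]; [L] bounds all of
    them uniformly for the step count. *)
Variables (s t : 'I_n) (J : 'I_n -> nat) (L : nat).
Hypothesis J_le : forall u, (J u <= L)%N.
Hypothesis J_stop : forall u, walk_ended nb s t u (J u) \/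
  (size (nb s))%:R <= (J u).+1%:R * eps.
Hypothesis J_go : forall u i, (i < J u)%N -> ~~ walk_ended nb s t u i /\
  ~~ ((size (nb s))%:R <= i.+1%:R * eps).

Definition endpoints_inv (i : nat) (acc : R) (st : state R) : Prop :=
  [/\ nmem st 1 = s, nmem st 2 = t, nmem st 3 = size (nb s),
      rmem st 0 = eps & nmem st 5 = i /\ rmem st 1 = acc].

Definition walk_inv i acc u j (st : state R) : Prop :=
  endpoints_inv i acc st /\
  [/\ nmem st 6 = (walk nb s u j).1, nmem st 7 = (walk nb s u j).2 &
      nmem st 8 = j.+1].

Lemma walk_body_correct i acc u j st : walk_inv i acc u j st ->
  reaches nb walk_body st 10 (walk_inv i acc u j.+1).
Proof.
move=> [[e1 e2 e3 e4 [e5 e6]] [e7 e8 e9]].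
apply: (@reaches_seq _ _ _ _ _ _ 1 8); apply: reaches_neighbor.
apply: (@reaches_seq _ _ _ _ _ _ 2 5); apply: reaches_if.
rewrite beval_neq_test /=.
case: ifP => qE; [apply: reaches_neighbor | apply: reaches_nset];
  apply: (@reaches_seq _ _ _ _ _ _ 1 3); apply: reaches_nset;
  apply: (@reaches_seq _ _ _ _ _ _ 1 1); apply: reaches_nset;
  apply: reaches_nset; split=> //; split=> //=; rewrite /update /= ?e9 ?addn1 //;
  rewrite -e7 -e8; rewrite /update /= in qE; by rewrite qE.
Qed.

Lemma walk_guard_correct i acc u j st : walk_inv i acc u j st ->
  (j <= J u)%N -> beval st walk_guard = (j < J u)%N.
Proof.
move=> [[e1 e2 e3 e4 [e5 e6]] [e7 e8 e9]] jJ.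
rewrite /walk_guard [beval _ _]/= -/(beval st (neq_test _ _)).
rewrite -!eqn_leq e1 e2 e3 e4 e8 e9 -negb_or -/(walk_ended nb s t u j).
rewrite ltn_neqAle jJ andbT -negb_or; congr negb.
have [->|jNJ] := eqVneq j (J u).
  by case: (J_stop u) => ->; rewrite ?orbT.
have ltj : (j < J u)%N by rewrite ltn_neqAle jNJ.
by have [/negPf -> /negPf ->] := J_go ltj.
Qed.

(** A walk step costs 10 plus 1 for its guard; the 12 counts the failing guard and everything
    outside the loop. *)
Lemma neighbor_body_correct i st :
  let acc k := \sum_(u <- take k (nb s)) walk_weight R nb s u (J u) in
  (i < size (nb s))%N ->
  endpoints_inv i (acc i) st ->
  reaches nb neighbor_body st (L * 11 + 12) (endpoints_inv i.+1 (acc i.+1)).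
Proof.
move=> acc id [e1 e2 e3 e4 [e5 e6]].
pose u := nth s (nb s) i.
rewrite addnC; apply: (@reaches_seq _ _ _ _ _ _ 1 (10 + L * 11)).
apply: reaches_nset.
apply: (@reaches_seq _ _ _ _ _ _ 1 (8 + L * 11)); apply: reaches_neighbor.
apply: (@reaches_seq _ _ _ _ _ _ 1 (6 + L * 11)); apply: reaches_nset.
have -> : (6 + L * 11 = ((L * 11).+1 + 4).+1)%N by rewrite addSnnS addnC addnS.
apply: (@reaches_seq _ _ _ _ _ _ (L * 11).+1 4).
apply: (@reaches_le _ _ _ (J u * 11).+1 _ _ _ (walk_inv i (acc i) u (J u))).
- by rewrite ltnS leq_mul2r J_le orbT.
- move=> st' [[f1 f2 f3 f4 [f5 f6]] [f7 f8 f9]].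
  apply: (@reaches_seq _ _ _ _ _ _ 2 1); apply: reaches_if.
  have accS : acc i.+1 = acc i + walk_weight R nb s u (J u).
    by rewrite /acc (take_nth s) // -cats1 big_cat big_seq1.
  rewrite beval_neq_test /= f1 f8; case: ifP => wE;
    [apply: reaches_nset | apply: reaches_rset]; apply: reaches_nset;
    split=> //=; split; rewrite /update /= ?f5 ?addn1 // accS /walk_weight wE.
    by rewrite addr0.
  by rewrite f6 f9 div1r.
apply: reaches_while.
- move=> j st' jJ; exact: (fun H => walk_guard_correct H jJ).
- by move=> j st' _; exact: walk_body_correct.
split=> //; split=> //=; rewrite /update /= e1 // e5 neighbor_query_ord.
by rewrite (nth_map s).
Qed.

Lemma neighbor_loop_correct st : endpoints_inv 0 0 st ->
  reaches nb (Seq (While (BNot (NLe (ncell 3) (ncell 5))) neighbor_body)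
      (RSet (NConst 0) (RDiv (ROfNat (NConst 1)) (RMem (NConst 1))))) st
    (size (nb s) * (L * 11 + 13) + 3)
    (fun st' => rmem st' 0 = 1 / \sum_(u <- nb s) walk_weight R nb s u (J u)).
Proof.
move=> inv0; rewrite [(_ + 13)%N]addnS.
have -> k : (k + 3 = (k.+1 + 1).+1)%N by rewrite addn1 addn3.
apply: reaches_seq.
pose Inv i := endpoints_inv i
  (\sum_(u <- take i (nb s)) walk_weight R nb s u (J u)).
apply: (@reaches_le _ _ _ _ _ _ _ (Inv (size (nb s)))); first exact: leqnn.
  move=> st' [_ _ _ _ [_ accE]]; apply: reaches_rset.
  by rewrite /= /update /= accE take_size.
apply: (reaches_while (Inv := Inv)).
- by move=> i st' _ [_ _ e3 _ [e5 _]]; rewrite /= e3 e5 -ltnNge.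
- by move=> i st' id; exact: neighbor_body_correct.
- by rewrite /Inv take0 big_nil.
Qed.

End Endpoints.
End Program.

(** The swapping branch is the longer one: 8 steps with its test, plus two degree queries and three
    [Seq]. *)
Lemma program_start (R : realFieldType) n (nb : 'I_n -> seq 'I_n) (eps : R)
    (s t s0 t0 : 'I_n) m Q :
  (s0, t0) = (if (size (nb s) <= size (nb t))%N then (s, t) else (t, s)) ->
  (forall st, endpoints_inv nb eps s0 t0 0 0 st ->
     reaches nb (Seq (While (BNot (NLe (ncell 3) (ncell 5))) neighbor_body)
       (RSet (NConst 0) (RDiv (ROfNat (NConst 1)) (RMem (NConst 1))))) st m Q) ->
  reaches nb resistance_program (init_config resistance_program s t eps).2
    (13 + m) Q.
Proof.
move=> st0E loop.
apply: (@reaches_seq _ _ _ _ _ _ 1 (11 + m)); apply: reaches_degree.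
apply: (@reaches_seq _ _ _ _ _ _ 1 (9 + m)); apply: reaches_degree.
apply: (@reaches_seq _ _ _ _ _ _ 8 m); apply: reaches_if.
rewrite /= !degree_query_ord; move: st0E; case: ifP => _ [? ?]; subst s0 t0.
  apply: (reaches_le (isT : (1 <= 7)%N) (fun _ H => H)); apply: reaches_nset.
  (* The neighbor index and the accumulator start at the default 0 of the initial memory. *)
  exact: loop.
apply: (@reaches_seq _ _ _ _ _ _ 1 5); apply: reaches_nset.
apply: (@reaches_seq _ _ _ _ _ _ 1 3); apply: reaches_nset.
apply: (@reaches_seq _ _ _ _ _ _ 1 1); apply: reaches_nset.
by apply: reaches_nset; apply: loop.
Qed.

(** * Numerical estimates and the final bound *)

Lemma ln_ln3_gt0 (R : realType) : 0 < ln (ln 3%:R) :> R.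
Proof.
(* The claim is e < 3. It follows from exp(-1/6) >= 5/6, because (5/6)^6 > 1/3. *)
apply: ln_gt0; rewrite -[ltLHS](@expRK R) ltr_ln ?posrE ?expR_gt0 ?ltr0n //.
have e6 : expR (- (1 / 6%:R)) >= 1 - 1 / 6%:R :> R by exact: expR_ge1Dx.
have : (1 - 1 / 6%:R) ^+ 6 <= expR (-1) :> R.
  have -> : -1 = 6%:R * - (1 / 6%:R) :> R by field.
  by rewrite expRM_natl ler_pXn2r // nnegrE ?expR_ge0 //; lra.
move=> le6; rewrite -[1 in ltLHS]opprK expRN.
have e0 : 0 < (1 - 1 / 6%:R) ^+ 6 :> R by rewrite exprn_gt0 //; lra.
rewrite invf_plt ?posrE ?expR_gt0 //.
by apply: lt_le_trans le6; lra.
Qed.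

(** The least [L] reaching [d] overshoots by less than [eps], which is below [d]. *)
Lemma nat_ceil_div (R : realType) (d eps : R) : 1 <= d -> 0 < eps < 1 ->
  exists L : nat, d <= L%:R * eps <= d *+ 2.
Proof.
move=> d1 /andP[e0 e1].
have exL : exists L : nat, d <= L%:R * eps.
  exists (Num.truncn (d / eps)).+1; rewrite -ler_pdivrMr //.
  by apply/ltW/truncnS_gt.
case: (ex_minnP exL) => -[|L] LP Lmin; first by rewrite mul0r in LP; lra.
exists L.+1; rewrite LP /=.
have : L%:R * eps < d by rewrite ltNge; apply/negP => /Lmin; rewrite ltnn.
by rewrite -natr1 mulrDl mul1r mulr2n; lra.
Qed.

Theorem theorem16 (R : realType) :
  exists (p : cmd) (C : R), 0 < C /\
  forall (eps : R), 0 < eps -> eps < 1 / 10%:R ->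
  forall (n : nat) (e : rel 'I_n) (nb : 'I_n -> seq 'I_n) (s t : 'I_n),
    symmetric e -> irreflexive e -> adjacency_lists e nb ->
    e s t ->
    (forall v : 'I_n, v != s -> v != t -> (degree e v <= 2)%N) ->
  exists k : nat,
    [/\ runs_in_time nb p s t eps k,
        99%:R / 100%:R <=
          output_prob nb
            (fun a => approximates (1 + eps) a (effective_resistance R e s t))
            k (init_config p s t eps)
      & (3 <= n)%N ->
        k%:R <= C * ((minn (degree e s ^ 2) (degree e t ^ 2))%:R
                     * ln n%:R ^+ 2 * ln (ln n%:R) / eps ^+ 2)].
Proof.
have lnln3 := ln_ln3_gt0 R.
(* The step bound is 16 + 13 d + 11 d L; times [eps ^+ 2], with L eps <= 2 d, it is at most (16 + 13
   + 22) d^2. Dividing by [ln (ln 3%:R)] makes the log log factor at least 1 for n >= 3. *)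
exists resistance_program, (51%:R / ln (ln 3%:R)); split; first exact: divr_gt0.
move=> eps eps0 eps1 n e nb s t e_sym e_irr nbP est deg2.
pose st0 := if (size (nb s) <= size (nb t))%N then (s, t) else (t, s).
have [s0 [t0 st0E]] : exists s0 t0, (s0, t0) = st0.
  by case: st0 => a b; exists a, b.
have [es0 deg20 erE minE] : [/\ e s0 t0,
    forall v, v != s0 -> v != t0 -> (degree e v <= 2)%N,
    effective_resistance R e s t = effective_resistance R e s0 t0 &
    minn (degree e s ^ 2) (degree e t ^ 2) = (size (nb s0) ^ 2)%N].
  rewrite !(degreeE _ nbP); move: st0E; rewrite /st0.
  case: leqP => le [-> ->].
    by split=> //; apply/minn_idPl; rewrite leq_sqr.
  split=> //; [by rewrite e_sym | by move=> v vt vs; apply: deg2| | ].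
    exact: effective_resistanceC.
  by apply/minn_idPr; rewrite leq_sqr ltnW.
set d := size (nb s0) in minE.
have d0 : (0 < d)%N.
  by have := (nbP s0).2 t0; rewrite es0 /d; case: (nb s0).
have d1 : 1 <= d%:R :> R by rewrite ler1n.
have [|L /andP[dL L2]] := @nat_ceil_div R d%:R eps d1.
  by apply/andP; split=> //; lra.
(* The negated guard at length [j.+1]. Index [L] always satisfies it through the length, so a least
   index [J u] exists. *)
pose stop u j := walk_ended nb s0 t0 u j || (d%:R <= j.+1%:R * eps).
have stopL u : stop u L.
  by rewrite /stop (le_trans dL) ?orbT // ler_pM2r // ler_nat.
pose J u := ex_minn (ex_intro _ L (stopL u)).
have JL u : (J u <= L)%N by rewrite /J; case: ex_minnP => j _; apply.
have Jstop u : walk_ended nb s0 t0 u (J u) \/ d%:R <= (J u).+1%:R * eps.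
  by rewrite /J; case: ex_minnP => j /orP.
have Jgo u i : (i < J u)%N ->
    ~~ walk_ended nb s0 t0 u i /\ ~~ (d%:R <= i.+1%:R * eps).
  rewrite /J; case: ex_minnP => j _ jmin ij; apply/andP.
  by rewrite -negb_or; apply: contraTN ij => /jmin; rewrite -leqNgt.
have [k [st' [kle ex outE]]] := program_start st0E
  (fun st => @neighbor_loop_correct R n nb eps s0 t0 J L JL Jstop Jgo st).
(* No random command is executed, so every output event has probability 0 or 1. *)
have outP E : output_prob nb E k (init_config resistance_program s t eps) =
    (E (1 / \sum_(u <- nb s0) walk_weight R nb s0 u (J u)))%:R.
  by have := ex E 0%N [::]; rewrite addn0 [RHS]/= outE.
exists k; split.
- by rewrite /runs_in_time outP.
- rewrite outP erE.
  have [x [Lx ER ER0]] := effective_resistance_potential R e_sym es0.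
  rewrite ER in ER0 *.
  rewrite (weights_approximate e_sym e_irr nbP es0 deg20 Lx ER0 eps0) //; last first.
    by move=> u _ i /Jgo[].
  by rewrite [nat_of_bool _]/=; lra.
- move=> n3; rewrite minE natrX.
  have ln3 : 1 < ln 3%:R :> R.
    rewrite ltNge; apply: contraL lnln3; rewrite -leNgt; exact: ln_le0.
  have ln3n : ln 3%:R <= ln n%:R :> R.
    by rewrite ler_ln ?posrE ?ltr0n ?ler_nat // (leq_trans _ n3).
  have lnlnn : ln (ln 3%:R) <= ln (ln n%:R) :> R.
    by rewrite ler_ln ?posrE //; lra.
  have kR : k%:R * eps ^+ 2 <= 51%:R * d%:R ^+ 2.
    have : k%:R <= 13%:R + ((d%:R * (L%:R * 11%:R + 13%:R)) + 3%:R) :> R.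
      by rewrite -!(natrD, natrM) ler_nat.
    move=> kdL; apply: le_trans (ler_wpM2r (sqr_ge0 eps) kdL) _.
    have dLe : d%:R * (L%:R * eps) * eps <= d%:R * (d%:R *+ 2) :> R.
      apply: le_trans _ (ler_wpM2l (ler0n _ _) L2).
      by rewrite ger_pMr; [lra | apply: mulr_gt0; lra].
    have d2 : d%:R <= d%:R ^+ 2 :> R by rewrite expr2 ler_peMr //; lra.
    have e2 : eps ^+ 2 <= 1 by rewrite expr_le1 //; lra.
    have d_e : d%:R * eps ^+ 2 <= d%:R ^+ 2 :> R.
      by apply: le_trans d2; rewrite ger_pMr //; lra.
    move: dLe; rewrite mulr2n; lra.
  have l2 : 1 <= ln n%:R ^+ 2 :> R by rewrite expr_ge1 //; lra.
  rewrite mulrA ler_pdivlMr ?exprn_gt0 //; apply: le_trans kR _.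
  have lnr : 1 <= ln (ln n%:R) / ln (ln 3%:R) :> R by rewrite ler_pdivlMr ?mul1r.
  rewrite [leRHS](_ : _ = 51%:R * d%:R ^+ 2 *
      (ln n%:R ^+ 2 * (ln (ln n%:R) / ln (ln 3%:R)))); last first.
    by field; rewrite gt_eqF.
  by rewrite ler_peMr ?mulr_ge0 ?exprn_ge0 // mulr_ege1.
Qed.
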